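(* (Rolling rule.) Let $L$ be a frame, let $(P;e)$ and $(Q;e')$ be $L$-complete lattices and let $f:(P;e)\to(Q;e')$ and $g:(Q;e')\to(P;e)$ be monotone maps. Then the following hold: (i) $g(\sqcap S_{f\circ g})=\sqcap S_{g\circ f}$. (ii) $\sqcap\big(g(S_{f\circ g})\big)=g(\sqcap S_{f\circ g})$.
   Context: A frame is a complete lattice $L$ (with bottom $0$, top $1$) satisfying $a\wedge\bigvee S=\bigvee_{s\in S}(a\wedge s)$ for all $a\in L$, $S\subseteq L$; its relative pseudocomplement is $a\to b=\bigvee\{x\in L\mid a\wedge x\le b\}$. $L^P$ is the set of all maps $P\to L$. An $L$-ordered set is a pair $(P;e)$ with $P$ a set and $e:P\times P\to L$ a map such that for all $x,y,z\in P$: (E1) $e(x,x)=1$; (E2) $e(x,y)\wedge e(y,z)\le e(x,z)$; (E3) $e(x,y)=e(y,x)=1$ implies $x=y$. For $S\in L^P$, an element $x_0\in P$ is the join of $S$, written $x_0=\sqcup S$, if for all $x\in P$: $S(x)\le e(x,x_0)$ and $\bigwedge_{y\in P}(S(y)\to e(y,x))\le e(x_0,x)$. It is the meet, $x_0=\sqcap S$, if for all $x\in P$: $S(x)\le e(x_0,x)$ and $\bigwedge_{y\in P}(S(y)\to e(x,y))\le e(x,x_0)$. Joins and meets are unique when they exist. $(P;e)$ is an $L$-complete lattice if $\sqcup S$ and $\sqcap S$ exist for every $S\in L^P$. A map $f:(P;e)\to(Q;e')$ is monotone if $e(x,y)\le e'(f(x),f(y))$ for all $x,y\in P$. For a self-map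 $k$ of an $L$-ordered set $(X;e_X)$, $S_k:X\to L$ is defined by $S_k(x)=e_X(k(x),x)$. Thus $S_{g\circ f}\in L^P$ and $S_{f\circ g}\in L^Q$. For $A\in L^Q$, $g(A)\in L^P$ denotes the image $g(A)(y)=\bigvee\{A(x)\mid x\in Q,\ g(x)=y\}$ for $y\in P$. *)

(* Defs.v *)
From HB Require Import structures.
#[warnings="-notation-overridden"]
From mathcomp Require Import all_boot all_order.
From mathcomp Require Import boolp classical_sets.

Set Implicit Arguments.
Unset Strict Implicit.
Unset Printing Implicit Defensive.

Import Order.TTheory.
Local Open Scope classical_set_scope.

(* The lattice operations, bounds and order come from tbLatticeType; the choice
   structure it includes is available classically on any type. *)
HB.mixin Record TBLattice_isFrame d (L : Type) of Order.TBLattice d L := {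
  supremums_neq0 : forall A : set L, supremums A !=set0;
  infimums_neq0 : forall A : set L, infimums A !=set0;
  meet_supremumr : forall (a : L) (A : set L),
    Order.meet a (supremum \bot%O A) =
    supremum \bot%O [set Order.meet a s | s in A]
}.

#[short(type="frameType")]
HB.structure Definition Frame d :=
  {L of TBLattice_isFrame d L & Order.TBLattice d L}.

Section FrameOperations.
Context {d : Order.disp_t} {L : frameType d}.
Implicit Types (A : set L) (a b : L).

(* The defaults \bot and \top are the actual values on the empty set. *)
Definition fsup A : L := supremum \bot%O A.
Definition finf A : L := infimum \top%O A.

Definition fimp a b : L := fsup [set x | (Order.meet a x <= b)%O].

Lemma fsupP A : supremums A (fsup A).
Proof.
rewrite /fsup /supremum; case: eqVneq => [->|_].
  by split=> [x []|x _]; rewrite ?le0x.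
by apply: xgetPex; exact: supremums_neq0.
Qed.

Lemma finfP A : infimums A (finf A).
Proof.
rewrite /finf /infimum; case: eqVneq => [->|_].
  by split=> [x []|x _]; rewrite ?lex1.
by apply: xgetPex; exact: infimums_neq0.
Qed.

End FrameOperations.

HB.mixin Record isLOrdered d (L : frameType d) (P : Type) := {
  lrel : P -> P -> L;
  lrel_refl : forall x : P, lrel x x = \top%O;
  lrel_trans : forall x y z : P,
    (Order.meet (lrel x y) (lrel y z) <= lrel x z)%O;
  lrel_anti : forall x y : P, lrel x y = \top%O -> lrel y x = \top%O -> x = y
}.

#[short(type="lorderedType")]
HB.structure Definition LOrdered d (L : frameType d) := {P of isLOrdered d L P}.

Section JoinsAndMeets.
Context {d : Order.disp_t} {L : frameType d} {P : lorderedType L}.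
Implicit Types (S : P -> L) (x : P).

Definition is_ljoin S (x0 : P) : Prop := forall x,
  (S x <= lrel x x0)%O /\
  (finf [set fimp (S y) (lrel y x) | y in [set: P]] <= lrel x0 x)%O.

Definition is_lmeet S (x0 : P) : Prop := forall x,
  (S x <= lrel x0 x)%O /\
  (finf [set fimp (S y) (lrel x y) | y in [set: P]] <= lrel x x0)%O.

End JoinsAndMeets.

HB.mixin Record LOrdered_isLComplete d (L : frameType d) P
    of LOrdered d L P := {
  ex_ljoin : forall S : P -> L, exists x0 : P, is_ljoin S x0;
  ex_lmeet : forall S : P -> L, exists x0 : P, is_lmeet S x0
}.

#[short(type="lcompleteType")]
HB.structure Definition LComplete d (L : frameType d) :=
  {P of LOrdered d L P & LOrdered_isLComplete d L P}.

Section LCompleteOperations.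
Context {d : Order.disp_t} {L : frameType d} {P : lcompleteType L}.
Implicit Type S : P -> L.

Definition ljoin S : P := sval (cid (ex_ljoin S)).
Definition lmeet S : P := sval (cid (ex_lmeet S)).

Lemma ljoinP S : is_ljoin S (ljoin S).
Proof. by rewrite /ljoin; case: cid. Qed.

Lemma lmeetP S : is_lmeet S (lmeet S).
Proof. by rewrite /lmeet; case: cid. Qed.

End LCompleteOperations.

Definition lmonotone d (L : frameType d) (P Q : lorderedType L)
    (f : P -> Q) : Prop :=
  forall x y : P, (lrel x y <= lrel (f x) (f y))%O.

Definition lprefix d (L : frameType d) (X : lorderedType L) (k : X -> X)
    (x : X) : L :=
  lrel (k x) x.

Definition limage d (L : frameType d) (P Q : Type) (g : Q -> P) (A : Q -> L)
    (y : P) : L :=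
  fsup [set A x | x in [set x | g x = y]].

(* Main.v *)
(* By the Knaster-Tarski argument [q = lmeet (lprefix (f \o g))] is a fixed point
   of [f \o g], so [g q] is a fixed point of [g \o f].  Hence the two [L]-subsets
   of [P] whose meet is taken both have value [1] at [g q]; since [g q] is also a
   lower bound of each of them, it is their meet. *)
Require Import Defs.
From mathcomp Require Import all_boot all_order.
From mathcomp Require Import boolp classical_sets.

Set Implicit Arguments.
Unset Strict Implicit.
Unset Printing Implicit Defensive.

Import Order.TTheory.

Lemma fimp_top (d : Order.disp_t) (L : frameType d) (a b : L) :
  (a <= b)%O -> fimp a b = \top%O.
Proof.
move=> ab; apply/eqP; rewrite -le1x.
have [ub _] := fsupP [set x | (Order.meet a x <= b)%O].
by apply: ub; rewrite /= meetx1.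
Qed.

Lemma lrel_trans_le (d : Order.disp_t) (L : frameType d) (P : lorderedType L)
    (a : L) (x y z : P) :
  (a <= lrel x y)%O -> (a <= lrel y z)%O -> (a <= lrel x z)%O.
Proof.
by move=> axy ayz; apply: le_trans (lrel_trans x y z); rewrite lexI axy.
Qed.

Lemma lmonotone_top (d : Order.disp_t) (L : frameType d)
    (P Q : lorderedType L) (f : P -> Q) (x y : P) :
  lmonotone f -> lrel x y = \top%O -> lrel (f x) (f y) = \top%O.
Proof. by move=> f_mono xy; apply/eqP; rewrite -le1x -xy f_mono. Qed.

Section MeetTheory.
Context {d : Order.disp_t} {L : frameType d} {P : lcompleteType L}.
Implicit Types (S : P -> L) (x : P) (k : P -> P).

Lemma lmeet_lb S x : (S x <= lrel (lmeet S) x)%O.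
Proof. by have [] := lmeetP S x. Qed.

(** For a lower bound in full degree, every implication in the infimum that defines the meet is
    [\top]. *)
Lemma lmeet_glb S x :
  (forall y, (S y <= lrel x y)%O) -> lrel x (lmeet S) = \top%O.
Proof.
move=> lbx; apply/eqP; rewrite -le1x.
have [_] := lmeetP S x; apply: le_trans.
have [_ glb] := finfP [set fimp (S y) (lrel x y) | y in [set: P]].
by apply: glb => _ [y _ <-]; rewrite fimp_top.
Qed.

Lemma lmeet_attained S x :
  (forall y, (S y <= lrel x y)%O) -> S x = \top%O -> lmeet S = x.
Proof.
move=> lbx Sx; apply: (@lrel_anti _ L); last exact: lmeet_glb.
by apply/eqP; rewrite -le1x -Sx lmeet_lb.
Qed.

Lemma lmeet_lprefix_fixed k :
  lmonotone k -> k (lmeet (lprefix k)) = lmeet (lprefix k).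
Proof.
move=> k_mono; set q := lmeet _.
have kq_q : lrel (k q) q = \top%O.
  (* The degree of [k x] below [x] bounds that of [q] below [x], hence that of [k q] below [k x];
     composing with [k x] below [x] makes [k q] a lower bound. *)
  apply: lmeet_glb => x; apply: (@lrel_trans_le _ _ _ _ _ (k x)) => //.
  exact: le_trans (lmeet_lb (lprefix k) x) (k_mono _ _).
(* By monotonicity [lprefix k] is [\top] at [k q], so its lower bound [q] lies below [k q]. *)
apply: (@lrel_anti _ L) => //; apply/eqP; rewrite -le1x.
by rewrite -(lmonotone_top k_mono kq_q) (lmeet_lb (lprefix k)).
Qed.

End MeetTheory.

Theorem theorem3p9 (d : Order.disp_t) (L : frameType d)
    (P Q : lcompleteType L) (f : P -> Q) (g : Q -> P)
    (f_mono : lmonotone f) (g_mono : lmonotone g) :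
  g (lmeet (lprefix (f \o g))) = lmeet (lprefix (g \o f)) /\
  lmeet (limage g (lprefix (f \o g))) = g (lmeet (lprefix (f \o g))).
Proof.
have fg_mono : lmonotone (f \o g).
  by move=> x y; apply: le_trans (g_mono x y) (f_mono _ _).
have := lmeet_lprefix_fixed fg_mono.
have := lmeet_lb (lprefix (f \o g)).
set q := lmeet _ => q_lb /= fgq; split.
  apply/esym/lmeet_attained => [x|]; last by rewrite /lprefix /= fgq lrel_refl.
  (* Applying [f] bounds [lprefix (g \o f) x] by [lprefix (f \o g) (f x)], so [q_lb] applies at
     [f x]. *)
  apply: (@lrel_trans_le _ _ _ _ _ (g (f x))) => //.
  apply: le_trans (f_mono _ _) _.
  exact: le_trans (q_lb (f x)) (g_mono _ _).
apply: lmeet_attained => [y|].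
  (* The image is a supremum over the fibre of [y], so each [x] with [g x = y] is bounded
     separately. *)
  have [_ lub] := fsupP [set lprefix (f \o g) x | x in [set x | g x = y]].
  apply: lub => _ [x <- <-].
  exact: le_trans (q_lb x) (g_mono _ _).
apply/eqP; rewrite -le1x.
have [ub _] := fsupP [set lprefix (f \o g) x | x in [set x | g x = g q]].
(* The fixed point [q] lies in the fibre of [g q] and contributes the value [\top]. *)
by apply: ub; exists q => //; rewrite /lprefix /= fgq lrel_refl.
Qed.
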